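(* We have $c_3\geq 5/18$. For every odd integer $k>3$ we have \[ c_k\geq \frac12-\frac{3k-4}{k^2(k-1)}, \] where the right-hand side is $\frac12-O(k^{-2})$.
   Context: Graphs are finite and simple. An induced path factor (IPF) of a graph $G$ is a set of induced paths in $G$ such that every vertex of $G$ is in exactly one of the paths; paths of any length are allowed, including trivial paths consisting of a single vertex. The induced path number $\rho(G)$ is the minimum number of paths in an IPF of $G$. For a fixed integer $k\geq 2$ and each $n$ for which a connected $k$-regular graph on $n$ vertices exists, let $\mathcal{M}_n$ be the maximum of $\rho(G)$ over all connected $k$-regular graphs $G$ on $n$ vertices. Define $c_k=\lim_{n\to\infty}\mathcal{M}_n/n$, the limit being taken over those $n$ for which such graphs exist (this limit exists for every $k\geq 2$). *)

(* Defs.v *)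
From HB Require Import structures.
From mathcomp Require Import all_boot all_order all_algebra.
From mathcomp Require Import all_classical all_reals all_analysis.

Set Implicit Arguments.
Unset Strict Implicit.
Unset Printing Implicit Defensive.

Import Order.TTheory GRing.Theory Num.Theory.
Import numFieldNormedType.Exports.

Local Open Scope classical_set_scope.
Local Open Scope ring_scope.

(* A graph is an adjacency relation [e] on a finite vertex type. *)
Section Graph.
Variables (T : finType) (e : rel T).

Definition simple_graph : bool :=
  [forall x, ~~ e x x] && [forall x, forall y, e x y == e y x].

Definition connected_graph : bool :=
  (0 < #|T|)%N && [forall x, forall y, connect e x y].

Definition regular_graph (k : nat) : bool :=
  [forall x, #|[set y | e x y]%SET| == k].

(* [s] lists the vertices of an induced path from one end to the other. *)
Definition induced_path (s : seq T) : bool :=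
  [&& (0 < size s)%N, uniq s &
      [forall i : 'I_(size s), forall j : 'I_(size s),
         e (tnth (in_tuple s) i) (tnth (in_tuple s) j)
         == ((j == i.+1 :> nat) || (i == j.+1 :> nat))]].

(* An induced path, being an induced subgraph, is identified with its vertex
   set, so that its two traversals count as the same path. *)
Definition induces_path (B : {set T}) : bool :=
  [exists s : #|B|.-tuple T, ([set x in s]%SET == B) && induced_path s].

Definition induced_path_factor (P : {set {set T}}) : bool :=
  finset.partition P [set: T]%SET && [forall B in P, induces_path B].

(* The default [#|T|] is the size of the factor into trivial paths, so it
   does not affect the minimum. *)
Definition induced_path_number : nat :=
  \big[minn/#|T|]_(P : {set {set T}} | induced_path_factor P) #|P|.

End Graph.

(* The graph on [{0, ..., n-1}] with set of ordered adjacent pairs [E]. *)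
Definition adj (n : nat) (E : {set 'I_n * 'I_n}) : rel 'I_n :=
  fun x y => (x, y) \in E.

Definition connected_regular (k n : nat) (E : {set 'I_n * 'I_n}) : bool :=
  [&& simple_graph (adj E), connected_graph (adj E) & regular_graph (adj E) k].

Definition max_induced_path_number (k n : nat) : nat :=
  \max_(E : {set 'I_n * 'I_n} | connected_regular k E)
     induced_path_number (adj E).

(* The orders [n] for which a connected [k]-regular graph exists. *)
Definition admissible_order (k : nat) : set nat :=
  [set n | exists E : {set 'I_n * 'I_n}, connected_regular k E].

Definition c (R : realType) (k : nat) : R :=
  lim (((max_induced_path_number k n)%:R / n%:R : R)
       @[n --> within (admissible_order k) \oo]).

(* Main.v *)
Require Import Defs.
From HB Require Import structures.
From mathcomp Require Import all_boot zify.

Set Implicit Arguments.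
Unset Strict Implicit.
Unset Printing Implicit Defensive.

(* Let [k = 2h + 1] and let a blob be [K_(k+1)] minus an edge; its induced path
   factors have at least [h + 1] paths. A gadget is a vertex [w] joined to the
   two deficient vertices of each of [h] blobs: all its degrees are [k], except
   that [w] has one edge left. Take a closed chain of [m] hubs of degree [k],
   consecutive hubs having one common neighbour, and attach a gadget to every
   neighbour of a hub for each edge that it misses. Removing a set [S] of
   vertices increases the size of an induced path factor by at most [|S|],
   since a vertex lies on at most two edges of a path. If [S] consists of the
   hubs and the vertices [w], then blobs and isolated vertices remain, which
   gives the bound for [k > 3]. If [k = 3], let [S] consist of the neighbours of
   the hubs: hubs and gadgets on 5 vertices remain, and the latter need 2 paths
   each.

   Two connected [k]-regular graphs can be glued by deleting an edge on a cycle
   of each and adding two edges across. Isolating the four vertices concerned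
   shows that the path numbers add up to within 8, so [M_n - 8] is superadditive
   on the semigroup of admissible orders, and Fekete's argument shows that
   [M_n / n] converges along it to the supremum of the [(M_n - 8) / n]. *)

(** * Paths and the edges used by an induced path factor *)

Section InducedPaths.
Variables (T : finType) (e : rel T).

Lemma induced_pathP (s : seq T) (x y : T) : induced_path e s ->
  x \in s -> y \in s ->
  e x y = (index y s == (index x s).+1) || (index x s == (index y s).+1).
Proof.
case/and3P=> _ us /'forall_forallP H xs ys.
have lx : (index x s < size s)%N by rewrite index_mem.
have ly : (index y s < size s)%N by rewrite index_mem.
have /eqP := H (Ordinal lx) (Ordinal ly).
by rewrite !(tnth_nth x) /= !nth_index.
Qed.

Lemma induces_pathP (B : {set T}) : induces_path e B ->
  exists2 s : seq T, induced_path e s & B =i s.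
Proof.
case/existsP=> s /andP[/eqP sB ps]; exists s => // x.
by rewrite -[in LHS]sB inE.
Qed.

Lemma sum_path_neighbours (m i : nat) :
  (\sum_(j < m) ((j == i.+1 :> nat) || (i == j.+1 :> nat)) <= 2)%N.
Proof.
have le1 (P : pred 'I_m) : (forall j j', P j -> P j' -> j = j' :> nat) ->
    (\sum_(j < m) P j <= 1)%N.
  move=> inj; rewrite -big_mkcond /= sum1_card.
  by apply/card_le1_eqP => j j' Pj Pj'; apply/val_inj/inj.
apply: (@leq_trans (\sum_(j < m) (j == i.+1 :> nat)
                    + \sum_(j < m) (i == j.+1 :> nat))).
  by rewrite -big_split /= leq_sum // => j _; do 2!case: eqP.
by rewrite (@leq_add _ _ 1 1) //; apply: le1 => j j' /eqP ? /eqP ?; lia.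
Qed.

(** A path on [m > 0] vertices has [m - 1] edges, each giving two darts (ordered adjacent pairs).
    The summand 2 avoids truncated subtraction and covers [m = 0]. *)
Lemma sum_path_edges (m : nat) :
  (m.*2 <= 2 + \sum_(i < m) \sum_(j < m)
      ((j == i.+1 :> nat) || (i == j.+1 :> nat)))%N.
Proof.
elim: m => [|m IHm]; first by rewrite !big_ord0.
rewrite big_ord_recr /= (eq_bigr (fun i : 'I_m => \sum_(j < m)
      ((j == i.+1 :> nat) || (i == j.+1 :> nat)) + (m == i.+1))%N); last first.
  move=> i _; rewrite big_ord_recr /=; congr (_ + _)%N.
  by have := ltn_ord i; do 2!case: eqP => //; lia.
rewrite big_split big_ord_recr /=.
case: m IHm => [|m] IHm; first by rewrite !big_ord0.
(* The two new darts are those between the last two positions. *)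
have h1 : (0 < \sum_(i < m.+1) (m.+1 == i.+1))%N.
  by rewrite big_ord_recr /= eqxx addn1.
have h2 : (0 < \sum_(i < m.+1) ((i == m.+2 :> nat) || (m.+1 == i.+1 :> nat)))%N.
  by rewrite big_ord_recr /= eqxx orbT addn1.
rewrite doubleS -(addn1 _.+1) -(addn1 _.*2) !addnA.
by rewrite (leq_trans _ (leq_addr _ _)) // !leq_add.
Qed.

Lemma induces_path_darts (B : {set T}) : induces_path e B ->
  (#|B|.*2 <= 2 + \sum_(x in B) \sum_(y in B) e x y)%N.
Proof.
case/induces_pathP=> s ps Bs; have us : uniq s by case/and3P: (ps).
have sum_s (F : T -> nat) : (\sum_(x in B) F x =
    \sum_(i < size s) F (tnth (in_tuple s) i))%N.
  transitivity (\sum_(x <- s) F x)%N; last by rewrite big_tnth.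
  by rewrite big_uniq //; apply: eq_bigl => x; rewrite Bs.
have -> : #|B| = size s by rewrite -(card_uniqP us); apply: eq_card.
apply: leq_trans (sum_path_edges (size s)) _; rewrite leq_add2l sum_s.
apply: leq_sum => i _; rewrite sum_s; apply: leq_sum => j _.
by case/and3P: ps => _ _ /'forall_forallP/(_ i j)/eqP->.
Qed.

Lemma induces_path_deg (B : {set T}) x : induces_path e B -> x \in B ->
  (\sum_(y in B) e x y <= 2)%N.
Proof.
case/induces_pathP=> s ps Bs; have us : uniq s by case/and3P: (ps).
rewrite Bs => xs.
have -> : (\sum_(y in B) e x y =
    \sum_(i < size s) e x (tnth (in_tuple s) i))%N.
  transitivity (\sum_(y <- s) e x y)%N; last by rewrite big_tnth.
  by rewrite big_uniq //; apply: eq_bigl => y; rewrite Bs.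
apply: leq_trans (sum_path_neighbours (size s) (index x s)).
apply: leq_sum => i _; rewrite (induced_pathP ps) ?mem_tnth //.
by rewrite (tnth_nth x) /= index_uniq.
Qed.

Lemma induces_path_no_triangle (B : {set T}) x y z : induces_path e B ->
  x \in B -> y \in B -> z \in B -> e x y -> e y z -> e x z -> False.
Proof.
case/induces_pathP=> s ps Bs; rewrite !Bs => xs ys zs.
by rewrite !(induced_pathP ps) //; lia.
Qed.

Lemma induces_path_no_square (B : {set T}) x y z t : induces_path e B ->
  x \in B -> y \in B -> z \in B -> t \in B -> x != z -> y != t ->
  e x y -> e y z -> e z t -> e t x -> False.
Proof.
case/induces_pathP=> s ps Bs; rewrite !Bs => xs ys zs ts.
have ind a b : a \in s -> b \in s -> a != b -> index a s <> index b s.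
  by move=> sa sb /eqP nab /(congr1 (nth a s)); rewrite !nth_index.
move=> /ind-/(_ xs zs) ixz /ind-/(_ ys ts) iyt.
by rewrite !(induced_pathP ps) //; lia.
Qed.

End InducedPaths.

Section UsedEdges.
Variables (T : finType) (e : rel T) (P : {set {set T}}).
Hypothesis ipfP : induced_path_factor e P.

Definition used : rel T := fun x y => e x y && (pblock P x == pblock P y).

Let partP : partition P [set: T].
Proof. by case/andP: ipfP. Qed.

Let tiP : trivIset P.
Proof. by case/and3P: partP. Qed.

Let coverP x : x \in cover P.
Proof. by case/and3P: partP => /eqP->; rewrite inE. Qed.

Let block_path x : induces_path e (pblock P x).
Proof.
by case/andP: ipfP => _ /'forall_implyP; apply; rewrite pblock_mem.
Qed.

Let in_block x y : (y \in pblock P x) = (pblock P x == pblock P y).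
Proof. by rewrite eq_pblock. Qed.

Lemma used_adj x y : used x y -> e x y.
Proof. by case/andP. Qed.

Lemma used_sym : symmetric e -> symmetric used.
Proof. by move=> se x y; rewrite /used se eq_sym. Qed.

Lemma used_deg x : \sum_y used x y <= 2.
Proof.
apply: leq_trans (induces_path_deg (block_path x) (_ : x \in _)); last first.
  by rewrite mem_pblock.
rewrite [leqRHS]big_mkcond /=; apply: leq_sum => y _.
by rewrite in_block /used; case: eqP; rewrite ?andbT ?andbF.
Qed.

(** The three vertices share a block, and an induced path contains every edge of [e] between its
    vertices; so a closing edge in [e] already creates a cycle inside the path. The same reason
    excludes squares below. *)
Lemma used_no_triangle x y z : used x y -> used y z -> e x z -> False.
Proof.
case/andP=> exy /eqP bxy /andP[eyz /eqP byz].
apply: (induces_path_no_triangle (block_path x) _ _ _ exy eyz);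
  by rewrite ?in_block ?mem_pblock // ?bxy ?byz.
Qed.

Lemma used_no_square x y z t : x != z -> y != t ->
  used x y -> used y z -> used t x -> e z t -> False.
Proof.
move=> nxz nyt /andP[exy /eqP bxy] /andP[eyz /eqP byz] /andP[etx /eqP btx] ezt.
apply: (induces_path_no_square (block_path x) _ _ _ _ nxz nyt exy eyz ezt etx);
  by rewrite ?in_block ?mem_pblock // ?btx ?bxy ?byz.
Qed.

(** Summing over the blocks shows that the size of the factor is at least the number of vertices
    minus the number of used edges. Lower bounds on path numbers thus become upper bounds on used
    darts. *)
Lemma used_card : #|T|.*2 <= #|P|.*2 + \sum_x \sum_y used x y.
Proof.
have -> : #|T| = \sum_(B in P) #|B| by rewrite -(card_partition partP) cardsT.
have -> : \sum_x \sum_y used x y =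
    \sum_(B in P) \sum_(x in B) \sum_(y in B) e x y.
  rewrite (eq_bigl (fun x => x \in cover P)); last by move=> x; rewrite coverP.
  rewrite big_trivIset //; apply: eq_bigr => B PB; apply: eq_bigr => x Bx.
  rewrite [RHS]big_mkcond; apply: eq_bigr => y _ /=.
  rewrite /used -in_block (def_pblock tiP PB Bx).
  by case: ifP; rewrite ?andbT ?andbF.
rewrite -[#|P|]sum1_card -!mul2n !big_distrr -big_split /=.
apply: leq_sum => B PB; rewrite muln1 mul2n induces_path_darts //.
by case/andP: ipfP => _ /'forall_implyP; apply.
Qed.

End UsedEdges.

(** Handshake argument: the order of ['I_n] splits the darts into two halves that symmetry
    exchanges. *)
Lemma odd_sum_sym n (r : rel 'I_n) : symmetric r -> irreflexive r ->
  ~~ odd (\sum_x \sum_y r x y).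
Proof.
move=> rs ri.
have -> : \sum_x \sum_y r x y =
    \sum_(x < n) \sum_(y < n | x < y) r x y
    + \sum_(x < n) \sum_(y < n | y < x) r x y.
  rewrite -big_split /=; apply: eq_bigr => x _.
  rewrite [X in _ = X + _]big_mkcond [X in _ = _ + X]big_mkcond -big_split /=.
  by apply: eq_bigr => y _; case: ltngtP => [||/val_inj->]; rewrite ?ri ?addn0.
rewrite [X in _ + X](exchange_big_dep predT) //=.
under [X in _ + X]eq_bigr do under eq_bigr do rewrite rs.
by rewrite addnn odd_double.
Qed.

(** * Used darts in a blob, the complete graph on [2h + 2] vertices without the edge between 0 and
    1 *)

Definition blob_adj h : rel 'I_(h.*2.+2) :=
  fun x y => (x != y) && ~~ ((x < 2) && (y < 2)).
Arguments blob_adj : clear implicits.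

Section Blob.
Variables (h : nat) (r : rel 'I_(h.*2.+2)).
Hypotheses (r_adj : subrel r (blob_adj h)) (r_sym : symmetric r).
Hypothesis r_triangle :
  forall x y z, r x y -> r y z -> blob_adj h x z -> False.

Let u : 'I_(h.*2.+2) := ord0.
Let v : 'I_(h.*2.+2) := lift ord0 ord0.

Let r_irr : irreflexive r.
Proof. by move=> x; apply/negP => /r_adj; rewrite /blob_adj eqxx. Qed.

Let not_blob_adj x y : x != y -> ~ blob_adj h x y -> (x < 2) && (y < 2).
Proof. by rewrite /blob_adj => -> /=; case: (_ && _) => // /(_ isT). Qed.

Let lt2 (x : 'I_(h.*2.+2)) : x < 2 -> x = u \/ x = v.
Proof.
by case: x => [[|[|x]] lx] // _; [left | right]; apply: val_inj.
Qed.

(** Two distinct [r]-neighbours of [x] cannot be adjacent in the blob, and the only distinct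
    non-adjacent vertices are [u] and [v]. *)
Let deg_le x : \sum_y r x y <= 1 + (r x u && r x v).
Proof.
rewrite -big_mkcond /= sum1_card.
have [/andP[xu xv]|/negP nxuv] := boolP (r x u && r x v).
  have <- : #|[set u; v]| = 1 + true by rewrite cards2.
  apply/subset_leq_card/subsetP => y; rewrite !inE unfold_in => xy.
  apply: contraT; rewrite negb_or => /andP[yu yv].
  have [//|/negP] := boolP (blob_adj h u y).
    by move/(r_triangle _ xy); rewrite r_sym => /(_ xu).
  move/not_blob_adj; rewrite eq_sym => /(_ yu) /andP[_ /lt2[]] yE.
    by rewrite yE eqxx in yu.
  by rewrite yE eqxx in yv.
rewrite addn0; apply/card_le1_eqP => y z; rewrite !unfold_in => xy xz.
have [//|nyz] := eqVneq y z; case: nxuv; rewrite r_sym in xy.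
have /not_blob_adj := r_triangle xy xz.
move/(_ nyz) => /andP[/lt2 yE /lt2 zE]; rewrite r_sym in xy.
by case: yE zE nyz xy xz => -> [] -> //; rewrite ?eqxx // => _ -> ->.
Qed.

(* Only the common neighbour of [u] and [v] can be the middle of a path, so the
   sum of the degrees exceeds [2h + 2] by at most one; and it is even. *)
Lemma blob_darts : \sum_x \sum_y r x y <= h.*2.+2.
Proof.
suff : \sum_x \sum_y r x y <= h.*2.+3.
  rewrite leq_eqVlt => /predU1P[E|//].
  by have := odd_sum_sym r_sym r_irr; rewrite E /= odd_double.
apply: leq_trans (leq_sum _ (fun x _ => deg_le x)) _.
rewrite big_split /= sum1_card card_ord -(addn1 h.*2.+2) leq_add2l.
(* The common neighbours of [u] and [v] are neighbours of [u], of which there is at most one because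
   [r u u] is false. *)
have := deg_le u; rewrite r_irr addn0; apply: leq_trans.
rewrite leq_sum // => x _.
by rewrite r_sym; case: (r _ _); case: (r _ _).
Qed.

(** No vertex is now joined to both [u] and [v], so the other [2h] vertices have degree at most 1.
    This is the situation of a blob both of whose edges to the root of its gadget are used. *)
Lemma blob_darts_isolated :
  (forall x, r u x = false) -> (forall x, r v x = false) ->
  \sum_x \sum_y r x y <= h.*2.
Proof.
move=> u0 v0; rewrite 2!big_ord_recl /= -/u -/v.
under eq_bigr do rewrite u0; under [X in _ + (X + _)]eq_bigr do rewrite v0.
rewrite !big1_eq !add0n -[leqRHS]card_ord -sum1_card leq_sum // => x _.
by apply: leq_trans (deg_le _) _; rewrite r_sym u0.
Qed.

End Blob.

(** * Completing a graph to a regular one *)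

Lemma sum_option (T : finType) (F : option T -> nat) :
  \sum_o F o = F None + \sum_t F (Some t).
Proof.
rewrite (bigD1 None) //= (reindex_omap Some id) //=; last by case.
by congr (_ + _); apply: eq_bigl => t; rewrite eqxx.
Qed.

(** The summand [x < 2] is the edge that the vertices 0 and 1 will have to the root of the
    gadget. *)
Lemma blob_deg h (x : 'I_(h.*2.+2)) :
  (x < 2) + \sum_y blob_adj h x y = h.*2.+1.
Proof.
have [x2|x2] := ltnP x 2.
  rewrite 2!big_ord_recl /blob_adj x2 !andbF !add0n add1n; congr _.+1.
  rewrite -[RHS]card_ord -sum1_card; apply: eq_bigr => y _.
  by rewrite andbT; case: eqP x2 => [->|].
transitivity #|predC1 x|; last by rewrite cardC1 card_ord.
rewrite add0n -sum1_card [RHS]big_mkcond; apply: eq_bigr => y _.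
by rewrite /blob_adj [x < 2]ltnNge x2 andbT inE eq_sym; case: eqP.
Qed.

Lemma regular_graphE (T : finType) (e : rel T) k :
  regular_graph e k = [forall x, \sum_y e x y == k].
Proof.
apply: eq_forallb => x; congr (_ == _).
by rewrite -sum1dep_card [LHS]big_mkcond.
Qed.

Lemma connect_map (T T' : finType) (e : rel T) (e' : rel T') (f : T -> T') :
  (forall x y, e x y -> connect e' (f x) (f y)) ->
  forall x y, connect e x y -> connect e' (f x) (f y).
Proof.
move=> ee' x y /connectP[p xp ->] {y}; elim: p x xp => //= y p IHp x.
by case/andP=> /ee'/connect_trans + /IHp; apply.
Qed.

(** Each vertex is on at most two used edges, so at most [2 |S|] darts start in [S] and at most
    [2 |S|] end there. *)
Lemma sum_used_cover (T : finType) (e : rel T) (P : {set {set T}})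
    (S : pred T) : symmetric e -> induced_path_factor e P ->
  \sum_x \sum_y used e P x y <= 4 * #|S| +
    \sum_(x | ~~ S x) \sum_(y | ~~ S y) used e P x y.
Proof.
move=> es ipfP.
have S2 : \sum_(x | S x) \sum_y used e P x y <= 2 * #|S|.
  rewrite mulnC -sum_nat_const; apply: leq_sum => x _; exact: used_deg.
rewrite -[4]/(2 + 2) mulnDl (bigID S) /= -addnA.
apply: (leq_add S2); under eq_bigr do rewrite (bigID S) /=.
rewrite big_split /= leq_add2r; apply: leq_trans S2.
rewrite (exchange_big_dep S) //=; apply: leq_sum => x _.
rewrite [leqLHS]big_mkcond; apply: leq_sum => y _.
by rewrite (used_sym P es); case: ifP.
Qed.

Section Completion.
Variables (h : nat) (Q : finType) (q : rel Q).
Local Notation k := h.*2.+1.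

(* A free slot [(p, i)] stands for one of the [k - deg p] edges that are
   missing at [p]; it carries a gadget made of a vertex [None] adjacent to
   [p] and to the vertices [0] and [1] of [h] blobs. *)
Definition slot := {s : Q * 'I_k | \sum_p' q s.1 p' <= s.2}.
Definition completion := (Q + slot * option ('I_h * 'I_(h.*2.+2)))%type.

Definition gadget_adj : rel (option ('I_h * 'I_(h.*2.+2))) := fun o o' =>
  match o, o' with
  | None, Some (b, x) | Some (b, x), None => x < 2
  | Some (b, x), Some (b', x') => (b == b') && blob_adj h x x'
  | None, None => false
  end.

Definition completion_adj : rel completion := fun x y =>
  match x, y with
  | inl p, inl p' => q p p'
  | inl p, inr (w, o) | inr (w, o), inl p => ((val w).1 == p) && (o == None)
  | inr (w, o), inr (w', o') => (w == w') && gadget_adj o o'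
  end.
Local Notation g := completion_adj.

Lemma sum_completion (F : completion -> nat) :
  \sum_x F x = \sum_p F (inl p) + \sum_w (F (inr (w, None)) +
    \sum_b \sum_x F (inr (w, Some (b, x)))).
Proof.
rewrite big_sumType /=; congr (_ + _).
transitivity (\sum_w \sum_o F (inr (w, o))).
  by rewrite pair_bigA; apply: eq_bigr => -[].
apply: eq_bigr => w _; rewrite sum_option pair_bigA; congr (_ + _).
by apply: eq_bigr => -[].
Qed.

Lemma card_completion :
  #|{: completion}| = #|Q| + #|{: slot}| * (1 + h * h.*2.+2).
Proof.
by rewrite card_sum card_prod card_option card_prod !card_ord add1n.
Qed.

Hypothesis (q_deg : forall p, \sum_p' q p p' <= k).

Lemma card_slots p : #|[pred i : 'I_k | \sum_p' q p p' <= i]| =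
  k - \sum_p' q p p'.
Proof.
move: (\sum_p' _) (q_deg p) => d dk.
rewrite -sum1_card (eq_bigl (fun i : 'I_k => d <= i)) //.
rewrite -(big_mkord (fun i => d <= i) (fun=> 1)) (big_cat_nat (leq0n d) dk) //=.
rewrite big_nat_cond big_pred0 => [|i]; last by lia.
rewrite big_nat_cond (eq_bigl (fun i => (d <= i < k) && true));
  last by move=> i; lia.
by rewrite -big_nat_cond sum_nat_const_nat muln1.
Qed.

Lemma card_slot : #|{: slot}| = \sum_p (k - \sum_p' q p p').
Proof.
rewrite card_sig -sum1_card.
under [RHS]eq_bigr do rewrite -card_slots -sum1_card.
by rewrite pair_big_dep.
Qed.

Lemma completion_regular : regular_graph g k.
Proof.
rewrite regular_graphE; apply/forallP => -[p|[w [[b x]|]]]; apply/eqP.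
- rewrite sum_completion /= (eq_bigr (fun w : slot => (val w).1 == p : nat)).
    rewrite -(big_sub (fun s : Q * 'I_k => \sum_p' q s.1 p' <= s.2)
      (fun s => s.1 == p : nat)).
    rewrite -(pair_big_dep predT (fun p' (i : 'I_k) => \sum_p'' q p' p'' <= i)
      (fun p' _ => p' == p : nat)) /= [X in _ + X](bigD1 p) //=.
    rewrite [X in _ + (_ + X)]big1.
      by rewrite addn0 eqxx sum1_card card_slots subnKC.
    by move=> p' /negPf->; rewrite big1.
  move=> w _; rewrite andbT big1 ?addn0 // => b _.
  by rewrite big1 // => x; rewrite andbF.
- rewrite sum_completion /= big1 => [|p _]; last by rewrite andbF.
  rewrite add0n (bigD1 w) //= eqxx.
  rewrite [X in _ + X]big1 /= => [|w' nww']; last first.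
    rewrite eq_sym (negPf nww') /= big1 // => b' _.
    by rewrite big1.
  rewrite (bigD1 b) //= eqxx [X in _ + (_ + X)]big1 => [|b' nbb']; last first.
    by rewrite eq_sym (negPf nbb') big1.
  by rewrite !addn0 blob_deg.
- rewrite sum_completion /= (bigD1 (val w).1) //= eqxx big1 => [|p]; last first.
    by rewrite eq_sym andbT => /negPf->.
  rewrite addn0 (bigD1 w) //= eqxx /=.
  rewrite [X in _ + (_ + X)]big1 => [|w' nww']; last first.
    rewrite eq_sym (negPf nww') /= big1 // => b' _.
    by rewrite big1.
  rewrite add0n addn0 (eq_bigr (fun=> 2)) => [|b _]; last first.
    by rewrite !big_ord_recl big1.
  by rewrite sum_nat_const card_ord add1n muln2.
Qed.

Hypothesis q_simple : simple_graph q.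

Let q_irr p : q p p = false.
Proof. by case/andP: q_simple => /forallP/(_ p)/negPf. Qed.

Let q_sym : symmetric q.
Proof. by case/andP: q_simple => _ /'forall_forallP H x y; apply/eqP/H. Qed.

Lemma completion_sym : symmetric g.
Proof.
move=> [p|[w o]] [p'|[w' o']] //=; rewrite eq_sym; congr andb.
case: o o' => [[b x]|] [[b' x']|] //=.
by rewrite eq_sym /blob_adj [x == _]eq_sym [(x < 2) && _]andbC.
Qed.

Lemma completion_simple : simple_graph g.
Proof.
apply/andP; split; last by apply/'forall_forallP => x y; rewrite completion_sym.
apply/forallP => -[p|[w [[b x]|]]] /=; first by rewrite q_irr.
  by rewrite /blob_adj !eqxx.
by rewrite eqxx.
Qed.

Let gadget_connected w o : connect g (inr (w, None)) (inr (w, o)).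
Proof.
have near b (x : 'I_(h.*2.+2)) : x < 2 ->
    connect g (inr (w, None)) (inr (w, Some (b, x))).
  by move=> x2; apply: connect1; rewrite /= eqxx.
case: o => [[b x]|]; last exact: connect0.
have [/near//|x2] := ltnP x 2.
apply: connect_trans (near b ord0 isT) (connect1 _).
rewrite /= eqxx /blob_adj [x < 2]ltnNge x2 andbF andbT.
by rewrite eqxx; apply: contraTneq x2 => <-.
Qed.

Lemma completion_connected : connected_graph q -> connected_graph g.
Proof.
case/andP=> Q0 /'forall_forallP qc.
apply/andP; split; first by rewrite card_sum addn_gt0 Q0.
have gs := sym_connect_sym completion_sym.
have to_base x : exists p, connect g (inl p) x.
  case: x => [p|[w o]]; first by exists p; apply: connect0.
  exists (val w).1; apply: connect_trans (gadget_connected w o).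
  by apply: connect1; rewrite /= !eqxx.
apply/'forall_forallP => x y; have [px xP] := to_base x.
have [py yP] := to_base y; rewrite gs in xP.
apply: connect_trans xP (connect_trans _ yP).
by apply: connect_map (qc px py) => p p' pp'; apply: connect1.
Qed.

End Completion.

(** * Counting used darts in a completion *)

Section CompletionFactor.
Variables (h : nat) (Q : finType) (q : rel Q).
Hypothesis (q_simple : simple_graph q).
Local Notation k := h.*2.+1.
Local Notation V := (completion h q).
Local Notation g := (@completion_adj h Q q).

Variable P : {set {set V}}.
Hypothesis ipfP : induced_path_factor g P.
Local Notation u := (used g P).

Let u_sym : symmetric u.
Proof. exact/used_sym/completion_sym. Qed.

Let u0 x y : ~~ g x y -> u x y = false.
Proof. by apply: contraNF => /used_adj. Qed.

Let blob_used w b : rel 'I_(h.*2.+2) :=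
  fun x y => u (inr (w, Some (b, x))) (inr (w, Some (b, y))).

Let blob_used_adj w b : subrel (blob_used w b) (blob_adj h).
Proof. by move=> x y /used_adj /=; rewrite !eqxx. Qed.

Let blob_used_sym w b : symmetric (blob_used w b).
Proof. by move=> x y; apply: u_sym. Qed.

Let blob_used_triangle w b x y z : blob_used w b x y -> blob_used w b y z ->
  blob_adj h x z -> False.
Proof.
by move=> xy yz xz; apply: (used_no_triangle ipfP xy yz); rewrite /= !eqxx.
Qed.

Let blob_used_darts w b : \sum_x \sum_y blob_used w b x y <= h.*2.+2.
Proof.
apply: blob_darts; [exact: blob_used_adj|exact: blob_used_sym|].
exact: blob_used_triangle.
Qed.

Let root_used w b : \sum_x u (inr (w, None)) (inr (w, Some (b, x))) =
  u (inr (w, None)) (inr (w, Some (b, ord0)))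
  + u (inr (w, None)) (inr (w, Some (b, lift ord0 ord0))).
Proof.
rewrite 2!big_ord_recl big1 ?addn0 // => x _.
by rewrite u0 //= eqxx.
Qed.

(** If at most one edge from the root to the blob is used, the blob bound [2h + 2] grows by at most
    2. If both are used, the blob vertices 0 and 1 have no used edge inside the blob, since any
    neighbour there would close a 4-cycle through the root; then the count is at most [2h + 4]
    again. *)
Let gadget_darts w b : \sum_x \sum_y blob_used w b x y
  + 2 * \sum_x u (inr (w, None)) (inr (w, Some (b, x))) <= h.*2.+4.
Proof.
rewrite root_used; have := blob_used_darts w b.
case w0: (u _ _); case w1: (u _ _); rewrite ?addn0; try by lia.
move=> _; suff: \sum_x \sum_y blob_used w b x y <= h.*2 by lia.
have free x y : u (inr (w, None)) (inr (w, Some (b, x))) ->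
    u (inr (w, None)) (inr (w, Some (b, y))) -> x < 2 -> y < 2 -> x != y ->
    forall z, blob_used w b x z = false.
  move=> wx wy x2 y2 nxy z; apply/negP => xz; rewrite u_sym in wy.
  apply: (used_no_square ipfP _ _ wx xz wy).
  - by apply/eqP.
  - by apply: contraNneq nxy => -[->].
  have := blob_used_adj xz; rewrite /= !eqxx /blob_adj x2 y2 andbT /=.
  by case/andP=> _ z2; rewrite (negPf z2) andbT; apply: contraNneq z2 => ->.
apply: blob_darts_isolated.
- exact: blob_used_sym.
- exact: blob_used_triangle.
- by apply: free w0 w1 _ _ _.
- by apply: free w1 w0 _ _ _.
Qed.

(** [A] will be the set of hubs. Removing [A] and all roots of gadgets leaves isolated base vertices
    and disjoint blobs, each with at most [2h + 2] used darts. *)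
Lemma completion_factor_blobs (A : {set Q}) :
  (forall p p', p \notin A -> p' \notin A -> ~~ q p p') ->
  #|{: V}|.*2 <= #|P|.*2 + 4 * (#|A| + #|{: slot h q}|)
    + #|{: slot h q}| * (h * h.*2.+2).
Proof.
move=> indep; apply: leq_trans (used_card ipfP) _; rewrite -addnA leq_add2l.
pose S (x : V) := match x with inl p => p \in A | inr (w, o) => o == None end.
have -> : #|A| + #|{: slot h q}| = #|S|.
  rewrite -!sum1_card [RHS]big_mkcond sum_completion; congr (_ + _).
    by rewrite big_mkcond.
  by apply: eq_bigr => w _; rewrite big1 // => b _; rewrite big1.
apply: leq_trans (sum_used_cover S (completion_sym q_simple) ipfP) _.
rewrite leq_add2l.
have far p y : p \notin A -> ~~ S y -> u (inl p) y = false.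
  case: y => [p'|[w o]] /= Ap Ay; rewrite u0 //=; first exact: indep.
  by rewrite (negPf Ay) andbF.
rewrite big_mkcond sum_completion /= big1 => [|p _]; last first.
  by case: ifP => // Ap; rewrite big1 // => y Ay; rewrite far.
rewrite add0n -sum_nat_const leq_sum // => w _.
rewrite add0n -[X in X * _](card_ord h) -sum_nat_const leq_sum // => b _.
apply: leq_trans (blob_used_darts w b); apply: leq_sum => x _.
rewrite big_mkcond sum_completion /= big1 => [|p _]; last first.
  by case: ifP => // Ap; rewrite u_sym far.
rewrite add0n (bigD1 w) //= [X in _ + X]big1 => [|w' nw]; last first.
  rewrite add0n big1 // => b' _; rewrite big1 // => y _.
  by rewrite u0 //= eq_sym (negPf nw).
rewrite add0n addn0 (bigD1 b) //= [X in _ + X]big1 ?addn0 // => b' nb.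
by rewrite big1 // => y _; rewrite u0 //= [b == _]eq_sym (negPf nb) andbF.
Qed.

(** Here the hubs [A] are kept and the other base vertices are removed. The hubs have no gadgets and
    become isolated, and whole gadgets remain, with at most [2h + 4] darts for each blob and its
    edges to the root. *)
Lemma completion_factor_gadgets (A : {set Q}) :
  (forall p p', p \in A -> p' \in A -> ~~ q p p') ->
  (forall p, p \in A -> \sum_p' q p p' = k) ->
  #|{: V}|.*2 <= #|P|.*2 + 4 * #|~: A| + #|{: slot h q}| * (h * h.*2.+4).
Proof.
move=> indep full; apply: leq_trans (used_card ipfP) _.
rewrite -addnA leq_add2l.
pose S (x : V) := if x is inl p then p \notin A else false.
have -> : #|~: A| = #|S|.
  rewrite -!sum1_card [RHS]big_mkcond sum_completion.
  rewrite [X in _ + X]big1 ?addn0 => [|w _].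
    by rewrite big_mkcond; apply: eq_bigr => p _; rewrite inE.
  by rewrite big1 // => b _; rewrite big1.
apply: leq_trans (sum_used_cover S (completion_sym q_simple) ipfP) _.
rewrite leq_add2l.
have far p y : p \in A -> ~~ S y -> u (inl p) y = false.
  case: y => [p'|[w o]] /= Ap Ay; rewrite u0 //=.
    by apply: indep => //; rewrite -[_ \in _]negbK.
  (* A vertex of full degree [k] carries no slot, since the index of a slot is below [k]. *)
  apply/negP => /andP[/eqP wp _]; have := valP w; rewrite wp full //.
  by rewrite leqNgt ltn_ord.
rewrite big_mkcond sum_completion /= big1 => [|p _]; last first.
  case: ifPn => //; rewrite negbK => Ap.
  by rewrite big1 // => y Ay; rewrite far.
rewrite add0n -sum_nat_const leq_sum // => w _.
have inner o : \sum_(y | ~~ S y) u (inr (w, o)) y =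
    u (inr (w, o)) (inr (w, None)) +
    \sum_b \sum_x u (inr (w, o)) (inr (w, Some (b, x))).
  rewrite big_mkcond sum_completion /= big1 => [|p _]; last first.
    by case: ifPn => //; rewrite negbK => Ap; rewrite u_sym far.
  rewrite add0n (bigD1 w) //= [X in _ + X]big1 ?addn0 // => w' nw.
  rewrite u0 ?big1 //= => [b _|]; last by rewrite eq_sym (negPf nw).
  by rewrite big1 // => x _; rewrite u0 //= eq_sym (negPf nw).
rewrite inner u0 ?add0n /=; last by rewrite andbF.
rewrite -big_split -[X in X * _](card_ord h) -sum_nat_const.
apply: leq_sum => b _ /=.
apply: leq_trans (gadget_darts w b).
(* The edges at the root are counted once from the root and once from the blob, whence the factor 2
   in [gadget_darts]. *)
under [X in _ + X]eq_bigr do rewrite inner u_sym.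
rewrite big_split /= [2 * _]mulSn mul1n [leqRHS]addnC -addnA !leq_add2l.
apply: leq_sum => x _.
rewrite (bigD1 b) //= [X in _ + X]big1 ?addn0 // => b' nb.
by rewrite big1 // => y _; rewrite u0 //= [b == _]eq_sym (negPf nb) andbF.
Qed.

End CompletionFactor.

(** * The ring graph *)

Section Ring.
Variables (n h : nat).
Hypothesis h_gt0 : 0 < h.
Local Notation m := n.+2.
Local Notation k := h.*2.+1.

(* Hub [i] is [inl i]; the neighbour [(i + 1, 0)] of hub [i + 1] is shared with
   hub [i]. *)
Definition ring := ('I_m + 'I_m * 'I_(h.*2))%type.

Definition ring_link (i : 'I_m) (p : 'I_m * 'I_(h.*2)) : bool :=
  (p.1 == i) || ((p.1 == ordS i) && (p.2 == 0 :> nat)).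

Definition ring_adj : rel ring := fun x y =>
  match x, y with
  | inl i, inr p | inr p, inl i => ring_link i p
  | _, _ => false
  end.

Lemma ring_simple : simple_graph ring_adj.
Proof.
apply/andP; split; first by apply/forallP => -[].
by apply/'forall_forallP => -[x|x] [y|y] /=.
Qed.

Let j0 : 'I_(h.*2) := Ordinal (etrans (double_gt0 h) h_gt0).

(** This holds because there are at least two hubs. It makes the neighbour that hub [i] shares with
    the next hub distinct from the [2h] neighbours of its own. *)
Let ordS_neq (i : 'I_m) : (ordS i == i) = false.
Proof.
apply/negP => /eqP/(congr1 val) /=; have := ltn_ord i.
rewrite [_ < _]leq_eqVlt => /predU1P[E|im].
  by rewrite E modnn => i0; rewrite -i0 in E.
by rewrite modn_small // => /eqP; rewrite eqn_leq ltnn.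
Qed.

Lemma ring_deg_hub i : \sum_y ring_adj (inl i) y = k.
Proof.
rewrite big_sumType /= big1 // add0n.
rewrite -(pair_bigA _ (fun i' j => ring_link i (i', j) : nat)) /=.
have -> : k = \sum_(i' < m) ((i' == i) * h.*2 + (i' == ordS i)).
  rewrite big_split /= -big_distrl /= -!big_mkcond /= !big_pred1_eq.
  by rewrite mul1n addn1.
apply: eq_bigr => i' _; rewrite /ring_link /=.
have [->|ni] := eqVneq i' i.
  by rewrite eq_sym ordS_neq addn0 sum_nat_const card_ord muln1 mul1n.
rewrite mul0n add0n; case: eqP => _ /=; last by rewrite big1.
by rewrite (bigD1 j0) //= big1 // => j; rewrite -val_eqE => /negPf->.
Qed.

Let ring_deg_join_le p : \sum_y ring_adj (inr p) y <= 2.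
Proof.
rewrite big_sumType /= [X in _ + X]big1 // addn0.
apply: (@leq_trans (\sum_(i < m) ((i == p.1) + (i == ord_pred p.1)))).
  apply: leq_sum => i _; rewrite /ring_link eq_sym; case: (i == _) => //=.
  rewrite -[p.1 in X in X <= _]ord_predK (inj_eq (@ordS_inj _)) eq_sym.
  by case: (_ == _) => //=; case: (_ == _).
by rewrite big_split /= -!big_mkcond /= !big_pred1_eq.
Qed.

Lemma ring_deg p : \sum_y ring_adj p y <= k.
Proof.
case: p => [i|p]; first by rewrite ring_deg_hub.
by apply: leq_trans (ring_deg_join_le p) _; rewrite ltnS double_gt0.
Qed.

Lemma card_ring : #|{: ring}| = m * k.
Proof. by rewrite card_sum card_prod !card_ord mulnS. Qed.

(** Every edge has exactly one end at a hub, so the degrees add up to [2 m k], while [m k] vertices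
    of degree [k] would require [m k^2]. *)
Lemma card_ring_slot : #|{: slot h ring_adj}| = m * k * (k - 2).
Proof.
rewrite (card_slot ring_deg) sumnB => [|p _]; last exact: ring_deg.
rewrite sum_nat_const -card_ring mulnBr; congr (_ - _).
rewrite big_sumType /=; under eq_bigr do rewrite ring_deg_hub.
rewrite sum_nat_const card_ord card_ring muln2 -[RHS]addnn; congr (_ + _).
transitivity (\sum_(i < m) \sum_y ring_adj (inl i) y); last first.
  by under eq_bigr do rewrite ring_deg_hub; rewrite sum_nat_const card_ord.
under [RHS]eq_bigr do rewrite big_sumType /= big1 // add0n.
rewrite [RHS]exchange_big; apply: eq_bigr => p _.
by rewrite big_sumType /= [X in _ + X]big1 ?addn0.
Qed.

Lemma ring_connected : connected_graph ring_adj.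
Proof.
apply/andP; split; first by rewrite card_ring.
have rs : connect_sym ring_adj.
  apply: sym_connect_sym; case/andP: ring_simple => _ /'forall_forallP rs x y.
  exact/eqP.
have own i j : connect ring_adj (inl i) (inr (i, j)).
  by apply: connect1; rewrite /= /ring_link eqxx.
have step i : connect ring_adj (inl i) (inl (ordS i)).
  apply: (connect_trans (connect1 _ : connect _ _ (inr (ordS i, j0)))).
    by rewrite /= /ring_link /= eqxx orbT.
  by rewrite rs own.
have hub j (lt_jm : j < m) : connect ring_adj (inl ord0) (inl (Ordinal lt_jm)).
  elim: j lt_jm => [|j IHj] lt_jm.
    by rewrite (_ : ord0 = Ordinal lt_jm) //; apply: val_inj.
  apply: connect_trans (IHj (ltnW lt_jm)) _.
  rewrite (_ : Ordinal lt_jm = ordS (Ordinal (ltnW lt_jm))) //.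
  by apply: val_inj; rewrite /= modn_small.
have all x : connect ring_adj (inl ord0) x.
  case: x => [[j lt_jm]|[i j]]; first exact: hub.
  by apply: connect_trans (own i j); case: i.
by apply/'forall_forallP => x y; apply: connect_trans (all y); rewrite rs.
Qed.

Local Notation G := (@completion_adj h ring ring_adj).

Lemma card_ring_completion :
  #|{: completion h ring_adj}| = m * k * (1 + (k - 2) * (1 + h * h.*2.+2)).
Proof. by rewrite card_completion card_ring_slot card_ring; nia. Qed.

Let hubs : {set ring} := [set x | if x is inl _ then true else false].

Let card_hubs : #|hubs| = m.
Proof.
rewrite cardsE -sum1_card big_sumType /= big_pred0_eq addn0.
by rewrite sum1_card card_ord.
Qed.

Lemma ring_factor P : induced_path_factor G P ->
  #|{: completion h ring_adj}|.*2 <= #|P|.*2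
    + 4 * m + m * k * (k - 2) * (4 + h * h.*2.+2).
Proof.
move=> ipfP.
have indep p p' : p \notin hubs -> p' \notin hubs -> ~~ ring_adj p p'.
  by rewrite !inE; case: p => p; case: p'.
apply: leq_trans (completion_factor_blobs ring_simple ipfP indep) _.
rewrite card_hubs card_ring_slot; move: (m * k * _) (h * _) => s t.
by rewrite -!addnA leq_add2l; lia.
Qed.

Lemma ring_factor_cubic P : induced_path_factor G P ->
  #|{: completion h ring_adj}|.*2 <= #|P|.*2
    + 4 * (m * h.*2) + m * k * (k - 2) * (h * h.*2.+4).
Proof.
move=> ipfP.
have indep p p' : p \in hubs -> p' \in hubs -> ~~ ring_adj p p'.
  by rewrite !inE; case: p => p; case: p'.
have full p : p \in hubs -> \sum_p' ring_adj p p' = k.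
  by rewrite inE; case: p => // i _; apply: ring_deg_hub.
have := completion_factor_gadgets ring_simple ipfP indep full.
have -> : #|~: hubs| = m * h.*2.
  by have := cardsC hubs; rewrite card_hubs card_ring mulnS => /addnI.
by rewrite card_ring_slot.
Qed.

End Ring.

(** * Covers by sequences *)

Lemma bigminn_le (I : finType) (P : pred I) (F : I -> nat) x j :
  P j -> \big[minn/x]_(i | P i) F i <= F j.
Proof.
move=> Pj; have : j \in index_enum I by rewrite mem_index_enum.
elim: (index_enum I) => // i r IHr.
rewrite inE big_cons => /predU1P[<-|/IHr le].
  by rewrite Pj geq_minl.
by case: ifP => // _; apply: leq_trans (geq_minr _ _) le.
Qed.

Lemma bigminn_eq (I : finType) (P : pred I) (F : I -> nat) x :
  \big[minn/x]_(i | P i) F i = x \/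
  exists2 i, P i & \big[minn/x]_(i | P i) F i = F i.
Proof.
elim/big_rec: _ => [|i y Pi IHy]; first by left.
by rewrite /minn; case: ifP => _ //; right; exists i.
Qed.

Lemma uniq_flatten_inj (T : eqType) (L : seq (seq T)) s1 s2 x :
  uniq (flatten L) -> s1 \in L -> s2 \in L -> x \in s1 -> x \in s2 -> s1 = s2.
Proof.
elim: L => //= s L IHL; rewrite cat_uniq !inE => /and3P[_ /hasPn ns uL].
move=> /predU1P[->|Ls1] /predU1P[->|Ls2] // xs1 xs2.
- by have /ns/negP[] : x \in flatten L by apply/flattenP; exists s2.
- by have /ns/negP[] : x \in flatten L by apply/flattenP; exists s1.
- exact: IHL.
Qed.

Section PathCovers.
Variables (T : finType) (e : rel T).
Implicit Types (s : seq T) (L : seq (seq T)) (A : {pred T}).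

(* The empty sequence is allowed, so that deleting a vertex from a path
   always leaves two of them. *)
Definition induced_seq s := uniq s /\
  {in s &, forall x y,
    e x y = (index y s == (index x s).+1) || (index x s == (index y s).+1)}.

(** The analogue of an induced path factor for the subgraph induced on [A], with paths as sequences
    so that they can be cut at a vertex. *)
Definition path_cover A L :=
  [/\ {in L, forall s, induced_seq s}, uniq (flatten L) & flatten L =i A].

Lemma induced_seq_catl s1 s2 : induced_seq (s1 ++ s2) -> induced_seq s1.
Proof.
case=> + es; rewrite cat_uniq => /andP[us1 _]; split=> // x y xs ys.
by rewrite es ?mem_cat ?xs ?ys // !index_cat xs ys.
Qed.

Lemma induced_seq_catr s1 s2 : induced_seq (s1 ++ s2) -> induced_seq s2.
Proof.
case=> + es; rewrite cat_uniq => /and3P[_ /hasPn ns12 us2].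
split=> // x y xs ys.
rewrite es ?mem_cat ?xs ?ys ?orbT // !index_cat.
by rewrite (negPf (ns12 _ xs)) (negPf (ns12 _ ys)) -!addnS !eqn_add2l.
Qed.

Lemma induced_seq_head x y s : induced_seq [:: x, y & s] -> e x y.
Proof.
case=> /= /andP[xs _] es; rewrite es ?inE ?eqxx ?orbT //=.
by move: xs; rewrite inE negb_or ?eqxx => /andP[/negPf-> _].
Qed.

Lemma induced_path_seq s : induced_path e s -> induced_seq s.
Proof.
by move=> ps; split=> [|x y]; [case/and3P: ps | apply: induced_pathP].
Qed.

Lemma induced_seq_path s : s != [::] -> induced_seq s -> induced_path e s.
Proof.
move=> s0 [us es]; have x0 : T by case: s s0 {us es}.
apply/and3P; split=> //; first by rewrite lt0n size_eq0.
apply/'forall_forallP => i j; rewrite es ?mem_tnth // !(tnth_nth x0).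
by rewrite !index_uniq.
Qed.

Lemma induced_seq1 x : ~~ e x x -> induced_seq [:: x].
Proof.
move=> exx; split=> // y z /[!inE] /eqP-> /eqP->.
by rewrite /= eqxx (negPf exx).
Qed.

Lemma path_cover_delete A L v : path_cover A L -> v \in A ->
  exists2 L', path_cover [predD1 A & v] L' & size L' = (size L).+1.
Proof.
case=> iL uL LA; rewrite -LA => /flattenP[s Ls sv].
case/splitPr: Ls iL uL LA => L1 L2; case/splitPr: sv => s1 s2 iL uL LA.
have perm_L : perm_eq (flatten (L1 ++ (s1 ++ v :: s2) :: L2))
    (v :: flatten (L1 ++ s1 :: s2 :: L2)).
  rewrite !flatten_cat /= -!catA perm_sym -cat_rcons -cat1s perm_catCA.
  by rewrite cat_rcons perm_cat2l /= -[v :: s2 ++ _]cat1s -cat1s perm_catCA.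
exists (L1 ++ s1 :: s2 :: L2); last by rewrite !size_cat /= !addnS.
move: uL; rewrite (perm_uniq perm_L) => /= /andP[nv uL'].
split=> // [s'|x].
  rewrite mem_cat !inE => sL'; have iv : induced_seq (s1 ++ v :: s2).
    by apply: iL; rewrite mem_cat mem_head orbT.
  case/or4P: sL' => [sL|/eqP->|/eqP->|sL].
  - by apply: iL; rewrite mem_cat sL.
  - exact: induced_seq_catl iv.
  - by move: iv; rewrite -cat_rcons => /induced_seq_catr.
  - by apply: iL; rewrite mem_cat inE sL !orbT.
rewrite inE -LA (perm_mem perm_L) !inE; case: eqP => //= ->.
exact/negbTE.
Qed.

Lemma path_cover_add A L v : ~~ e v v -> v \notin A -> path_cover A L ->
  path_cover [predU1 v & A] ([:: v] :: L).
Proof.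
move=> evv vA [iL uL LA]; split=> [s||x] /=.
- by rewrite inE => /predU1P[->|/iL//]; apply: induced_seq1.
- by rewrite uL LA vA.
- by rewrite !inE LA.
Qed.

Lemma induces_paths_lift (Ps : seq {set T}) : all (induces_path e) Ps ->
  exists2 L, {in L, forall s, induced_seq s} & [seq [set x in s] | s <- L] = Ps.
Proof.
elim: Ps => [|B Ps IHP] /=; first by exists [::].
case/andP=> /induces_pathP[s ps Bs] /IHP[L iL <-].
exists (s :: L); last by congr (_ :: _); apply/setP => x; rewrite inE Bs.
by move=> s'; rewrite inE => /predU1P[->|/iL//]; apply: induced_path_seq.
Qed.

Lemma path_cover_of_factor P : induced_path_factor e P ->
  exists2 L, path_cover T L & size L = #|P|.
Proof.
case/andP=> partP /'forall_implyP iP.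
have [|L iL LP] := @induces_paths_lift (enum P).
  by apply/allP => B; rewrite mem_enum => /iP.
have sizeL : size L = #|P| by rewrite cardE -LP size_map.
have cover_L x : x \in flatten L.
  have : x \in cover P by case/and3P: partP => /eqP->; rewrite inE.
  case/bigcupP=> B + Bx; rewrite -mem_enum -LP => /mapP[s Ls BE].
  by apply/flattenP; exists s => //; rewrite BE inE in Bx.
exists L => //; split=> //.
(* Every vertex occurs and the total length is [#|T|], so no vertex occurs twice. *)
apply/card_uniqP; rewrite size_flatten.
transitivity #|T|; first by apply: eq_card => x; rewrite inE cover_L.
rewrite -cardsT (card_partition partP) -big_enum -LP.
rewrite big_map sumnE big_map; apply: eq_big_seq => s Ls.
by rewrite cardsE; apply/card_uniqP; case: (iL s Ls).
Qed.

Lemma path_number_cover : irreflexive e ->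
  exists2 L, path_cover T L &
  size L = induced_path_number e.
Proof.
move=> e0; rewrite /induced_path_number.
have [->|[P ipfP ->]] :=
  bigminn_eq (induced_path_factor e) (fun P => #|P|) #|T|.
  (* The default value of the minimum is attained by the trivial paths. *)
  exists [seq [:: x] | x <- enum T]; last by rewrite size_map -cardE.
  rewrite /path_cover flatten_seq1.
  split=> [s /mapP[x _ ->]||x]; first by apply: induced_seq1; rewrite e0.
    exact: enum_uniq.
  by rewrite mem_enum.
exact: path_cover_of_factor.
Qed.

Lemma path_number_le L : path_cover T L -> induced_path_number e <= size L.
Proof.
(* Blocks of a partition are nonempty, so the empty sequences are dropped. *)
case=> iL uL LT; pose Ps := [seq [set x in s] | s <- L & s != [::]].
have PsP B :
    reflect (exists2 s, s \in L /\ s != [::] & B = [set x in s]) (B \in Ps).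
  apply: (iffP mapP) => -[s]; rewrite ?mem_filter.
    by case/andP=> s0 Ls ->; exists s.
  by case=> Ls s0 ->; exists s => //; rewrite mem_filter s0.
apply: (@leq_trans #|[set:: Ps]|); last first.
  rewrite cardsE; apply: leq_trans (card_size _) _.
  by rewrite size_map size_filter count_size.
apply: bigminn_le; apply/andP; split; last first.
  apply/'forall_implyP => B; rewrite inE => /PsP[s [Ls s0] ->].
  have [us _] := iL s Ls; have sB : size s == #|[set x in s]|.
    by rewrite cardsE (card_uniqP us).
  apply/existsP; exists (Tuple sB); rewrite eqxx /=.
  exact/induced_seq_path/iL.
apply/and3P; split.
- apply/eqP/setP => x; rewrite inE; have : x \in flatten L by rewrite LT.
  case/flattenP=> s Ls xs; apply/bigcupP.
  exists [set x in s]; last by rewrite inE.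
  rewrite inE; apply/PsP; exists s => //; split=> //.
  by apply: contraTneq xs => ->.
- apply/trivIsetP => A B; rewrite !inE => /PsP[s [Ls _] ->] /PsP[s' [Ls' _] ->].
  apply: contraR => /pred0Pn[x]; rewrite /= !inE => /andP[xs xs'].
  by rewrite (uniq_flatten_inj uL Ls Ls' xs xs').
- rewrite inE; apply/PsP => -[[|x s] [_ //] _] /setP/(_ x).
  by rewrite !inE eqxx.
Qed.

End PathCovers.

(** [R] collects the sequences that miss the image of [f]. For the injection of a summand this
    restricts a cover to one side of a glued graph; with [R] empty it transports a cover along a
    bijection. *)
Lemma path_cover_preim (T T' : finType) (e : rel T) (e' : rel T') (f : T -> T')
    (A : {pred T'}) L L' R : injective f ->
  {in [preim f of A] &, forall x y, e x y = e' (f x) (f y)} ->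
  path_cover e' A L' -> perm_eq L' ([seq map f s | s <- L] ++ R) ->
  (forall x, f x \notin flatten R) -> path_cover e [preim f of A] L.
Proof.
move=> f_inj ef [iL' uL' L'A] permL RNf.
have permF : perm_eq (flatten L') (map f (flatten L) ++ flatten R).
  by rewrite map_flatten -flatten_cat perm_flatten.
have LA : flatten L =i [preim f of A].
  move=> x; rewrite [RHS]inE -L'A (perm_mem permF) mem_cat mem_map //.
  by rewrite (negPf (RNf x)) orbF.
split=> // [s Ls|]; last first.
  move: uL'; rewrite (perm_uniq permF) cat_uniq map_inj_uniq //.
  by case/andP.
have /iL'[us es] : map f s \in L'.
  by rewrite (perm_mem permL) mem_cat map_f.
split=> [|x y xs ys]; first by rewrite map_inj_uniq in us.
rewrite ef -?LA; try by apply/flattenP; exists s.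
by rewrite es ?map_f // !index_map.
Qed.

(** * Gluing two regular graphs along edges *)

Section DeleteEdge.
Variables (T : finType) (e : rel T).
Hypothesis e_simple : simple_graph e.

Let e_irr : irreflexive e.
Proof. by move=> x; apply: negbTE; case/andP: e_simple => /forallP. Qed.

Let e_sym : symmetric e.
Proof. by case/andP: e_simple => _ /'forall_forallP H x y; apply/eqP/H. Qed.

Definition delete_edge a b : rel T := fun x y =>
  e x y && ~~ ((x == a) && (y == b) || (x == b) && (y == a)).

Lemma delete_edge_sym a b : symmetric (delete_edge a b).
Proof.
move=> x y; rewrite /delete_edge e_sym orbC.
by rewrite [(x == a) && _]andbC [(x == b) && _]andbC.
Qed.

Lemma delete_edge_deg a b x : e a b ->
  \sum_y e x y = \sum_y delete_edge a b x y + ((x == a) + (x == b)).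
Proof.
move=> eab; have nab : a != b by apply: contraTneq eab => ->; rewrite e_irr.
have sum1 (c : T) : \sum_y (y == c) = 1 by rewrite -big_mkcond big_pred1_eq.
rewrite -[X in _ + (X + _)]muln1 -[X in _ + (_ + X)]muln1.
rewrite -{1}(sum1 b) -(sum1 a).
rewrite !big_distrr -!big_split /=; apply: eq_bigr => y _.
rewrite /delete_edge; have [->|nxa] := eqVneq x a.
  rewrite (negPf nab) /= orbF mul1n mul0n addn0.
  by have [->|_] := eqVneq y b; rewrite ?eab ?andbT ?addn0.
rewrite mul0n add0n.
have [->|_] := eqVneq x b; last by rewrite mul0n andbT addn0.
have [->|_] := eqVneq y a; last by rewrite /= muln0 andbT addn0.
by rewrite e_sym eab.
Qed.

(* Otherwise, among all pairs of an edge [x y] and the side [y] of it, take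
   one whose component after deletion of the edge is smallest; an edge
   from [y] to another neighbour cuts off a smaller component. *)
Lemma exists_cycle_edge (k : nat) : 1 < k -> 0 < #|T| -> regular_graph e k ->
  exists a b, e a b /\ connect (delete_edge a b) a b.
Proof.
rewrite regular_graphE => k1 /card_gt0P[x0 _] /forallP deg.
have other x y : exists2 z, e y z & z != x.
  have : 1 < \sum_z e y z by rewrite (eqP (deg y)).
  rewrite -big_mkcond sum1_card (cardD1 x) => lt1.
  have /card_gt0P[z] : 0 < #|[predD1 e y & x]|.
    by case: (x \in _) lt1 => //; apply: ltnW.
  by rewrite !inE => /andP[nzx eyz]; exists z.
have [y0 ex0 _] := other x0 x0.
have [/existsP[a /existsP[b /andP[eab cab]]]|none] :=
  boolP [exists a, exists b, e a b && connect (delete_edge a b) a b].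
  by exists a, b.
have bridge a b : e a b -> ~~ connect (delete_edge a b) a b.
  move=> eab; apply: contra none => cab; apply/existsP; exists a.
  by apply/existsP; exists b; rewrite eab.
have connect_symm u v := sym_connect_sym (delete_edge_sym u v).
suff small n x y : e x y -> #|connect (delete_edge x y) y| < n -> False.
  by case: (small _ _ _ ex0 (ltnSn _)).
elim: n x y => // n IHn x y exy; rewrite ltnS => len.
have [z eyz nzx] := other x y; apply: (IHn y z eyz); apply: leq_trans len.
(* Without the edge [y z], the component of [z] omits [y]. Its paths therefore survive the deletion
   of [x y], and it lies properly inside the component of [y]. *)
apply: proper_card; apply/properP; split; last first.
  exists y; first exact: connect0.
  by apply: contra (bridge _ _ eyz); rewrite connect_symm.
apply/subsetP => v /connectP[p zp ->] {v}.
apply: (@connect_trans _ _ z); first apply: connect1.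
  rewrite /delete_edge eyz (negPf nzx) andbF orbF negb_and.
  by rewrite orbC; apply/orP; right; apply: contraTneq exy => ->; rewrite e_irr.
apply/connectP; exists p => //.
apply: (@sub_in_path _ (predC1 y) _ _ _ _ _ _ zp) => [u w uy wy|].
  case/andP=> euw _; rewrite /delete_edge euw.
  by rewrite (negPf uy) (negPf wy) !andbF.
apply/allP => u pu; apply: contraNneq (bridge _ _ eyz) => uy.
by rewrite connect_symm; apply: (path_connect zp); rewrite -uy.
Qed.

End DeleteEdge.

Section Glue.
Variables (T1 T2 : finType) (e1 : rel T1) (e2 : rel T2).
Variables (a b : T1) (c d : T2).

Definition glue : rel (T1 + T2) := fun x y =>
  match x, y with
  | inl x, inl y => delete_edge e1 a b x y
  | inr x, inr y => delete_edge e2 c d x y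
  | inl x, inr y | inr y, inl x => (x == a) && (y == c) || (x == b) && (y == d)
  end.

Hypotheses (s1 : simple_graph e1) (s2 : simple_graph e2).
Hypotheses (eab : e1 a b) (ecd : e2 c d).

Lemma glue_simple : simple_graph glue.
Proof.
case/andP: (s1) (s2) => /forallP i1 _ /andP[/forallP i2 _].
apply/andP; split.
  by apply/forallP => -[x|x] /=; rewrite negb_and ?i1 ?i2.
apply/'forall_forallP => -[x|x] [y|y] //=; apply/eqP; exact: delete_edge_sym.
Qed.

Let sum_cross (S S' : finType) (p q x : S) (r t : S') : p != q ->
  \sum_y ((x == p) && (y == r) || (x == q) && (y == t)) = (x == p) + (x == q).
Proof.
have sum1 (z : S') : \sum_y (y == z) = 1 by rewrite -big_mkcond big_pred1_eq.
move=> npq; have [->|_] /= := eqVneq x p.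
  rewrite (negPf npq) addn0 -[RHS](sum1 r).
  by apply: eq_bigr => y _; rewrite orbF.
by case: eqP => _; rewrite ?sum1 ?big1.
Qed.

Let neq_edge (T : finType) (e : rel T) x y : simple_graph e -> e x y -> x != y.
Proof.
by case/andP=> /forallP i _ exy; apply: contraTneq exy => ->; apply: i.
Qed.

Lemma glue_regular k : regular_graph e1 k -> regular_graph e2 k ->
  regular_graph glue k.
Proof.
rewrite !regular_graphE => /forallP r1 /forallP r2.
apply/forallP => -[x|x]; rewrite big_sumType /=.
  rewrite sum_cross ?(neq_edge s1) // -(delete_edge_deg s1) //; exact: r1.
under eq_bigr do rewrite andbC [(_ == b) && _]andbC.
rewrite sum_cross ?(neq_edge s2) // addnC -(delete_edge_deg s2) //; exact: r2.
Qed.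

(** Both deleted edges lie on cycles, so each side stays connected, and the new edge from [a] to [c]
    joins the sides. *)
Lemma glue_connected : connected_graph e1 -> connected_graph e2 ->
  connect (delete_edge e1 a b) a b -> connect (delete_edge e2 c d) c d ->
  connected_graph glue.
Proof.
case/andP=> T1_gt0 /'forall_forallP c1 /andP[_ /'forall_forallP c2] cab ccd.
have gs : connect_sym glue.
  apply: sym_connect_sym; case/andP: glue_simple => _ /'forall_forallP H x y.
  exact/eqP.
apply/andP; split; first by rewrite card_sum addn_gt0 T1_gt0.
have via (T : finType) (e : rel T) u v (f : T -> T1 + T2) :
    (forall x y, delete_edge e u v x y -> glue (f x) (f y)) ->
    connect (delete_edge e u v) u v ->
    forall x y, connect e x y -> connect glue (f x) (f y).
  move=> ef cuv; have fuv : connect glue (f u) (f v).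
    by apply: connect_map cuv => x y /ef; apply: connect1.
  apply: connect_map => x y exy.
  have [/ef/connect1//|] := boolP (delete_edge e u v x y).
  rewrite negb_and exy negbK /= => /orP[]/andP[/eqP-> /eqP->] //.
  by rewrite gs.
have join : connect glue (inl a) (inr c) by apply: connect1; rewrite /= !eqxx.
have l x y : connect glue (inl x) (inl y) by apply: (via _ e1 a b inl) (c1 x y).
have r x y : connect glue (inr x) (inr y) by apply: (via _ e2 c d inr) (c2 x y).
have all x : connect glue (inl a) x.
  by case: x => x; [apply: l | apply: connect_trans join (r _ _)].
by apply/'forall_forallP => x y; apply: connect_trans (all y); rewrite gs.
Qed.

Let cut : pred (T1 + T2) :=
  [predD1 [predD1 [predD1 [predD1 predT & inl a] & inl b] & inr c] & inr d].

(** All cross edges have their ends among [a], [b], [c], [d], so a path avoiding these four vertices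
    stays on one side. *)
Lemma glue_split (L : seq (seq (T1 + T2))) :
  {in L, forall s, induced_seq glue s} -> {subset flatten L <= cut} ->
  exists L1 L2,
    perm_eq L ([seq map inl s | s <- L1] ++ [seq map inr s | s <- L2]).
Proof.
elim: L => [|s L IHL] iL cL; first by exists [::], [::].
have {IHL}[|x Lx|L1 [L2 permL]] := IHL.
- by move=> t Lt; apply: iL; rewrite inE Lt orbT.
- by apply: cL; rewrite mem_cat Lx orbT.
have is_ : induced_seq glue s by apply: iL; rewrite mem_head.
have cs : {subset s <= cut} by move=> x xs; apply: cL; rewrite mem_cat xs.
have [[s1' ->]|[s2' ->]] :
  (exists s1, s = map inl s1) \/ (exists s2, s = map inr s2).
- elim: s {iL cL} is_ cs => [|x s IHs] is_ cs; first by left; exists [::].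
  have [||[s' sE]|[s' sE]] := IHs; rewrite ?sE.
  + by apply: (@induced_seq_catr _ _ [:: x]).
  + by move=> y ys; apply: cs; rewrite inE ys orbT.
  + case: x is_ cs => x is_ cs; first by left; exists (x :: s').
    case: s' sE is_ cs => [|y s'] -> /= is_ cs; first by right; exists [:: x].
    have := cs (inl y); rewrite /= !inE eqxx orbT => /(_ isT) ycut.
    have := induced_seq_head is_; case/orP=> /andP[/eqP yE _];
      by rewrite yE !eqxx ?andbF in ycut.
  + case: x is_ cs => x is_ cs; last by right; exists (x :: s').
    case: s' sE is_ cs => [|y s'] -> /= is_ cs; first by left; exists [:: x].
    have := cs (inr y); rewrite /= !inE eqxx orbT => /(_ isT) ycut.
    have := induced_seq_head is_; case/orP=> /andP[_ /eqP yE];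
      by rewrite yE !eqxx ?andbF in ycut.
- exists (s1' :: L1), L2; by rewrite perm_cons.
exists L1, (s2' :: L2).
apply: (@perm_trans _ (map inr s2' :: ([seq map inl s | s <- L1] ++
  [seq map inr s | s <- L2]))); first by rewrite perm_cons.
by rewrite /= -cat_rcons -cat_cons perm_cat2r perm_sym perm_rcons.
Qed.

Let path_number_le_add (T : finType) (e : rel T) u v A L : simple_graph e ->
    u != v -> A =i [predD1 [predD1 T & u] & v] -> path_cover e A L ->
  induced_path_number e <= (size L).+2.
Proof.
case/andP=> /forallP e0 _ nuv AE [iL uL LA].
apply: (@path_number_le _ _ ([:: u] :: [:: v] :: L)).
have: path_cover e [predU1 u & [predU1 v & A]] ([:: u] :: [:: v] :: L).
  apply: path_cover_add; rewrite ?e0 ?inE ?AE ?inE ?eqxx ?(negPf nuv) //.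
  by apply: path_cover_add; rewrite ?e0 ?AE ?inE ?eqxx.
case=> iL' uL' L'A; split=> // x; rewrite L'A !inE AE !inE.
by case: (x == u); case: (x == v).
Qed.

(** Deleting the four end vertices from a minimum cover adds one sequence each; putting them back as
    trivial paths on their own sides adds four more, hence 8. *)
Lemma glue_path_number :
  induced_path_number e1 + induced_path_number e2
    <= induced_path_number glue + 8.
Proof.
have g0 : irreflexive glue.
  by move=> x; apply: negbTE; case/andP: glue_simple => /forallP.
have nab := neq_edge s1 eab; have ncd := neq_edge s2 ecd.
have [L0 cL0 <-] := path_number_cover g0.
have [|L1 cL1 sL1] := path_cover_delete (v := inl a) cL0; first by [].
have [|L2 cL2 sL2] := path_cover_delete (v := inl b) cL1.
  by rewrite !inE /= ?andbT; apply: contraNneq nab => -[->].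
have [|L3 cL3 sL3] := path_cover_delete (v := inr c) cL2; first by [].
have [|L cL sL] := path_cover_delete (v := inr d) cL3.
  by rewrite !inE /= ?andbT; apply: contraNneq ncd => -[->].

have [||Ll [Lr permL]] := @glue_split L; first by case: cL.
  by case: cL => _ _ LA x; rewrite LA.
move: cL; set A := (X in path_cover _ X _) => cL.
have cl : path_cover e1 [preim inl of A] Ll.
  apply: (path_cover_preim _ _ cL permL) => [x y [] //|x y|x].
    rewrite !inE /= !andbT => /andP[xb xa] _.
    rewrite /delete_edge (negPf xa : x == a = false).
    by rewrite (negPf xb : x == b = false) andbT.
  by apply/flattenP => -[s /mapP[t _ ->] /mapP[]].
have permL' :
    perm_eq L ([seq map inr s | s <- Lr] ++ [seq map inl s | s <- Ll]).
  by apply: perm_trans permL _; rewrite perm_catC.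
have cr : path_cover e2 [preim inr of A] Lr.
  apply: (path_cover_preim _ _ cL permL') => [x y [] //|x y|x].
    rewrite !inE /= !andbT => /andP[xd xc] _.
    rewrite /delete_edge (negPf xc : x == c = false).
    by rewrite (negPf xd : x == d = false) andbT.
  by apply/flattenP => -[s /mapP[t _ ->] /mapP[]].
have /leq_add : induced_path_number e1 <= (size Ll).+2.
  apply: (path_number_le_add s1 nab _ cl) => x.
  by rewrite !inE /= !andbT.
have /[swap]/[apply] : induced_path_number e2 <= (size Lr).+2.
  apply: (path_number_le_add s2 ncd _ cr) => x.
  by rewrite !inE /= !andbT.
move/leq_trans; apply.
have := perm_size permL; rewrite size_cat !size_map sL sL3 sL2 sL1; lia.
Qed.

End Glue.

(** * The maximum path number: transfer to ordinals, superadditivity and the ring graphs *)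

Lemma path_number_ge (T : finType) (e : rel T) x :
  (forall P, induced_path_factor e P -> #|T|.*2 <= #|P|.*2 + x) ->
  #|T|.*2 <= (induced_path_number e).*2 + x.
Proof.
move=> geP; rewrite /induced_path_number.
have [->|[P ipfP ->]] :=
  bigminn_eq (induced_path_factor e) (fun P => #|P|) #|T|.
  exact: leq_addr.
exact: geP.
Qed.

Lemma path_number_le_card (T : finType) (e : rel T) :
  induced_path_number e <= #|T|.
Proof.
rewrite /induced_path_number; elim/big_rec: _ => // P x _ xT.
exact: leq_trans (geq_minr _ _) xT.
Qed.

Lemma max_path_number_le k n : max_induced_path_number k n <= n.
Proof.
apply/bigmax_leqP => E _; rewrite -[leqRHS]card_ord; exact: path_number_le_card.
Qed.

(** Brings graphs on arbitrary finite types, such as completions and glued graphs, to the vertex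
    sets over which the maximum is taken. *)
Lemma ordinal_copy (T : finType) (e : rel T) k :
  simple_graph e -> connected_graph e -> regular_graph e k ->
  exists2 E : {set 'I_#|T| * 'I_#|T|}, connected_regular k E &
    induced_path_number e <= induced_path_number (adj E).
Proof.
case/andP=> /forallP e0 /'forall_forallP es /andP[T0 /'forall_forallP ec] er.
pose E := [set p : 'I_#|T| * 'I_#|T| | e (enum_val p.1) (enum_val p.2)].
have adjE x y : adj E x y = e (enum_val x) (enum_val y) by rewrite /adj inE.
exists E.
  apply/and3P; split.
  - apply/andP; split; first by apply/forallP => x; rewrite adjE.
    by apply/'forall_forallP => x y; rewrite !adjE.
  - rewrite /connected_graph card_ord T0; apply/'forall_forallP => x y.
    rewrite -[x]enum_valK -[y]enum_valK; apply: connect_map (ec _ _) => u v euv.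
    by apply: connect1; rewrite adjE !enum_rankK.
  - move: er; rewrite !regular_graphE => /forallP er; apply/forallP => x.
    rewrite -(eqP (er (enum_val x))); apply/eqP.
    rewrite [RHS](reindex _ (onW_bij _ (@enum_val_bij T))) /=.
    by apply: eq_bigr => y _; rewrite adjE.
have irr : irreflexive (adj E) by move=> x; apply: negbTE; rewrite adjE.
have [L cL <-] := path_number_cover irr; rewrite -(size_map (map enum_val)).
apply: path_number_le.
apply: (path_cover_preim (R := [::]) enum_rank_inj _ cL) => [x y _ _||x //].
  by rewrite adjE !enum_rankK.
rewrite cats0 -map_comp -[X in perm_eq X]map_id.
rewrite (eq_map (g := id)) // => s /=.
by rewrite -map_comp -[RHS]map_id; apply: eq_map => x /=; rewrite enum_valK.
Qed.

Lemma max_path_number_ge (T : finType) (e : rel T) k :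
  simple_graph e -> connected_graph e -> regular_graph e k ->
  induced_path_number e <= max_induced_path_number k #|T|.
Proof.
move=> es ec er; have [E krE] := ordinal_copy es ec er.
by move/leq_trans; apply; apply: leq_bigmax_cond.
Qed.

Lemma max_path_number_attained k n (E0 : {set 'I_n * 'I_n}) :
  connected_regular k E0 -> exists2 E : {set 'I_n * 'I_n},
    connected_regular k E &
    max_induced_path_number k n = induced_path_number (adj E).
Proof.
move=> kr0; rewrite /max_induced_path_number (bigmax_eq_arg E0) //.
by case: arg_maxnP => // E krE _; exists E.
Qed.

Lemma max_path_number_superadd k n1 n2
    (E1 : {set 'I_n1 * 'I_n1}) (E2 : {set 'I_n2 * 'I_n2}) : 1 < k ->
  connected_regular k E1 -> connected_regular k E2 ->
  (exists E : {set 'I_(n1 + n2) * 'I_(n1 + n2)}, connected_regular k E) /\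
  max_induced_path_number k n1 + max_induced_path_number k n2
    <= max_induced_path_number k (n1 + n2) + 8.
Proof.
move=> k1 /max_path_number_attained[{}E1 kr1 ->].
move=> /max_path_number_attained[{}E2 kr2 ->].
case/and3P: kr1 kr2 => s1 c1 r1 /and3P[s2 c2 r2].
have [|a [b [eab cab]]] := exists_cycle_edge s1 k1 _ r1; first by case/andP: c1.
have [|c [d [ecd ccd]]] := exists_cycle_edge s2 k1 _ r2; first by case/andP: c2.
have gs := glue_simple a b c d s1 s2.
have gc := glue_connected s1 s2 c1 c2 cab ccd.
have gr := glue_regular s1 s2 eab ecd r1 r2.
have := max_path_number_ge gs gc gr; have [E krE _] := ordinal_copy gs gc gr.
move: E krE; rewrite card_sum !card_ord => E krE le_max.
split; first by exists E.
apply: leq_trans (glue_path_number s1 s2 eab ecd) _; by rewrite leq_add2r.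
Qed.

Section RingExtremal.
Variables (n h : nat).
Hypothesis h_gt0 : 0 < h.
Local Notation m := n.+2.
Local Notation k := h.*2.+1.
Local Notation N := (m * k * (1 + (k - 2) * (1 + h * h.*2.+2))).

Let G : rel (completion h (@ring_adj n h)) :=
  completion_adj (q := @ring_adj n h).

Let G_simple : simple_graph G.
Proof. exact/completion_simple/ring_simple. Qed.

Let G_connected : connected_graph G.
Proof.
by apply: completion_connected; [apply: ring_simple|apply: ring_connected].
Qed.

Let G_regular : regular_graph G k.
Proof. exact/completion_regular/ring_deg. Qed.

Lemma ring_admissible : exists E : {set 'I_N * 'I_N}, connected_regular k E.
Proof.
have [E krE _] := ordinal_copy G_simple G_connected G_regular.
by move: E krE; rewrite card_ring_completion // => E krE; exists E.
Qed.

Let max_path_number_bound x :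
  (forall P, induced_path_factor G P -> N.*2 <= #|P|.*2 + x) ->
  N.*2 <= (max_induced_path_number k N).*2 + x.
Proof.
rewrite -card_ring_completion // => /path_number_ge/leq_trans; apply.
by rewrite leq_add2r leq_double max_path_number_ge.
Qed.

Lemma ring_max_path_number :
  N.*2 <= (max_induced_path_number k N).*2
    + (4 * m + m * k * (k - 2) * (4 + h * h.*2.+2)).
Proof.
apply: max_path_number_bound => P.
by rewrite -card_ring_completion // addnA; apply: ring_factor.
Qed.

Lemma ring_max_path_number_cubic :
  N.*2 <= (max_induced_path_number k N).*2
    + (4 * (m * h.*2) + m * k * (k - 2) * (h * h.*2.+4)).
Proof.
apply: max_path_number_bound => P.
by rewrite -card_ring_completion // addnA; apply: ring_factor_cubic.
Qed.

End RingExtremal.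

(** * Existence of the limit *)

From mathcomp Require Import all_order all_algebra.
From mathcomp Require Import all_classical all_reals all_analysis.
From mathcomp Require Import ring lra.

Import Order.TTheory GRing.Theory Num.Theory.
Import numFieldNormedType.Exports.

Local Open Scope classical_set_scope.
Local Open Scope ring_scope.

Section Fekete.
Variables (R : realType) (S : set nat) (f : nat -> nat) (C : nat).
Hypotheses (S_neq0 : S !=set0) (S_gt0 : forall n, S n -> (0 < n)%N).
Hypothesis S_add : forall n1 n2, S n1 -> S n2 ->
  S (n1 + n2)%N /\ (f n1 + f n2 <= f (n1 + n2) + C)%N.
Hypothesis f_le : forall n, (f n <= n)%N.

Let S_mul n q : S n -> S (q.+1 * n)%N.
Proof.
move=> Sn; elim: q => [|q IHq]; first by rewrite mul1n.
by rewrite mulSn; case: (S_add Sn IHq).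
Qed.

Let f_mul m s q : S m -> S s ->
  S (q * m + s)%N /\ (q * f m + f s <= f (q * m + s) + q * C)%N.
Proof.
move=> Sm Ss; elim: q => [|q [Sq IHq]]; first by rewrite !mul0n addn0.
have [SD fD] := S_add Sm Sq; rewrite !mulSn -!addnA; split=> //; lia.
Qed.

(** This replaces division with remainder, since small remainders need not belong to [S]. One
    representative [s] in [S] is chosen for each residue class modulo [m] that meets [S], and [B]
    bounds them all. *)
Let residues m : S m -> exists B, forall n, S n -> (B <= n)%N ->
  exists q s, [/\ S s, (s <= B)%N & n = (q * m + s)%N].
Proof.
move=> /S_gt0 m0.
suff below r : exists B, forall n, S n -> (n %% m < r)%N ->
    (B <= n)%N -> exists q s, [/\ S s, (s <= B)%N & n = (q * m + s)%N].
  by have [B HB] := below m; exists B => n Sn; apply: HB; rewrite ?ltn_mod.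
elim: r => [|r [B HB]]; first by exists 0%N.
have [[s [Ss sr]]|none] := pselect (exists s, S s /\ (s %% m = r)%N);
  last first.
  exists B => n Sn; rewrite ltnS leq_eqVlt => /predU1P[nr|]; last exact: HB.
  by case: none; exists n.
exists (maxn B s) => n Sn; rewrite ltnS leq_eqVlt geq_max.
case/predU1P=> [nr|nr] /andP[Bn sn].
  exists ((n - s) %/ m)%N, s; split=> //; first exact: leq_maxr.
  by rewrite divnK ?subnK // -eqn_mod_dvd // nr sr.
have [q [t [St tB ->]]] := HB n Sn nr Bn; exists q, t; split=> //.
by rewrite leq_max tB.
Qed.

(** Subtracting [C] turns [f] into a genuinely superadditive function on [S]. *)
Let slope n : R := ((f n)%:R - C%:R) / n%:R.

Let slopes := [set slope n | n in S].

Let slope_le1 n : S n -> slope n <= 1.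
Proof.
move=> /S_gt0 n0; rewrite ler_pdivrMr ?ltr0n // mul1r lerBlDr.
by rewrite -natrD ler_nat (leq_trans (f_le n)) ?leq_addr.
Qed.

Let has_sup_slopes : has_sup slopes.
Proof.
split; first by case: S_neq0 => n Sn; exists (slope n); exists n.
by exists 1 => _ [n Sn <-]; apply: slope_le1.
Qed.

(** For [n = q m + s], superadditivity gives [f n >= q (f m - C) = slope m * (n - s)]. Since
    [slope m <= 1] and [0 <= s <= B], the loss from [s] is at most [B]. *)
Let density_ge m : S m -> exists B : nat, forall n, S n -> (B <= n)%N ->
  slope m - B%:R / n%:R <= (f n)%:R / n%:R.
Proof.
move=> Sm; have [B HB] := residues Sm; exists B => n Sn Bn.
have n0 : 0 < n%:R :> R by rewrite ltr0n S_gt0.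
have m0 : 0 < m%:R :> R by rewrite ltr0n S_gt0.
rewrite lerBlDr -mulrDl ler_pdivlMr //.
have [q [s [Ss sB nE]]] := HB n Sn Bn.
have [_ /(leq_trans (leq_addr _ _))] := f_mul q Sm Ss; rewrite -nE => fle.
have {}fle : q%:R * (f m)%:R <= (f n)%:R + q%:R * C%:R :> R.
  by rewrite -!natrM -natrD ler_nat.
have a1 := slope_le1 Sm.
have aE : (f m)%:R = slope m * m%:R + C%:R.
  by rewrite divfK ?gt_eqF // subrK.
have sB' : s%:R <= B%:R :> R by rewrite ler_nat.
have s0 : 0 <= s%:R :> R by [].
have as_le : slope m * s%:R <= s%:R by rewrite ler_piMl.
rewrite aE in fle; rewrite [in leLHS]nE natrD natrM.
move: (slope m) (f n)%:R (q%:R) (m%:R) fle as_le sB' => a F Q M *; lra.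
Qed.

(** [S] contains the positive multiples of each of its elements, so it is unbounded. *)
Let filter_S : ProperFilter (within S \oo).
Proof.
split; last exact: within_filter.
case=> N _ HN; case: S_neq0 => n Sn.
apply: (HN (N.+1 * n)%N); last exact: S_mul.
by rewrite /= (@leq_trans N.+1) // leq_pmulr // S_gt0.
Qed.

Let inv_small (B : nat) (eps : R) :
  0 < eps -> \forall n \near \oo, B%:R / n%:R < eps.
Proof.
move=> eps0; near=> n; have n0 : 0 < n%:R :> R.
  by rewrite ltr0n; near: n; exists 1%N.
rewrite ltr_pdivrMr // -ltr_pdivrMl // mulrC.
by near: n; apply: nbhs_infty_gtr.
Unshelve. all: by end_near. Qed.

(** From above, [f n / n] exceeds [slope n], hence the supremum, by at most [C / n]. From below,
    [density_ge] is applied to an [m] whose slope is nearly the supremum. *)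
Lemma fekete_cvg :
  (f n)%:R / n%:R @[n --> within S \oo] --> (sup slopes : R).
Proof.
apply/cvgrPdist_lt => eps eps0.
have eps20 : 0 < eps / 2 by rewrite divr_gt0.
have [_ [m Sm <-] ltm] := sup_adherent eps20 has_sup_slopes.
have [B HB] := density_ge Sm.
rewrite near_withinE; near=> n => Sn.
have n0 : 0 < n%:R :> R by rewrite ltr0n S_gt0.
have le_sup : slope n <= sup slopes.
  by apply: ub_le_sup; [case: has_sup_slopes | exists n].
have le_n : slope m - B%:R / n%:R <= (f n)%:R / n%:R.
  by apply: HB => //; near: n; exists B.
have B_small : B%:R / n%:R < eps / 2 by near: n; apply: inv_small.
have C_small : C%:R / n%:R < eps by near: n; apply: inv_small.
have : (f n)%:R / n%:R = slope n + C%:R / n%:R by rewrite -mulrDl subrK.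
rewrite ltr_norml; lra.
Unshelve. all: by end_near. Qed.

Lemma fekete_lim n : S n ->
  ((f n)%:R - C%:R) / n%:R <=
    lim (((f n)%:R / n%:R : R) @[n --> within S \oo]).
Proof.
move=> Sn; have FS := filter_S; rewrite (cvg_lim _ fekete_cvg) //.
by apply: ub_le_sup; [case: has_sup_slopes | exists n].
Qed.

End Fekete.

(** * Lower bounds for the limit from the ring graphs *)

Lemma lower_limit_le (R : realType) (x y : R) (C : nat) :
  (forall n : nat, x - C%:R / n.+2%:R <= y) -> x <= y.
Proof.
move=> xy; apply/ler_addgt0Pr => eps eps0.
have [n] : exists n : nat, C%:R / n.+2%:R < eps.
  have [n nbig] : exists n : nat, C%:R / eps < n%:R.
    by exists (Num.bound (C%:R / eps)); rewrite archi_boundP // divr_ge0 // ltW.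
  exists n; rewrite ltr_pdivrMr ?ltr0n // mulrC -ltr_pdivrMr //.
  by apply: lt_trans nbig _; rewrite ltr_nat.
by move=> small; have := xy n; move: (_ / _) small => d *; lra.
Qed.

Section LowerBound.
Variables (R : realType) (h : nat).
Hypothesis h_gt0 : (0 < h)%N.
Local Notation k := h.*2.+1.
Local Notation U := (k * (1 + (k - 2) * (1 + h * h.*2.+2)))%N.

Lemma c_ge_density n : admissible_order k n ->
  ((max_induced_path_number k n)%:R - 8%:R) / n%:R <= c R k.
Proof.
apply: (@fekete_lim R (admissible_order k) (max_induced_path_number k) 8).
- exists (2 * k * (1 + (k - 2) * (1 + h * h.*2.+2)))%N.
  exact: ring_admissible.
- by move=> m [E /and3P[_ /andP[]]]; rewrite card_ord.
- move=> n1 n2 [E1 kr1] [E2 kr2].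
  by apply: max_path_number_superadd kr1 kr2; rewrite ltnS double_gt0.
- exact: max_path_number_le.
Qed.

(** [U] is the number of vertices per hub and [X] bounds the used darts per hub. The loss 8 from
    gluing contributes at most [8 / (n + 2)], as [U >= 1], and vanishes as the number [n + 2] of
    hubs grows. *)
Lemma c_ge_ring X :
  (forall n, ((n.+2 * U).*2 <= (max_induced_path_number k (n.+2 * U)).*2
    + n.+2 * X)%N) ->
  1 - X%:R / (U.*2)%:R <= c R k.
Proof.
move=> HX; apply: (@lower_limit_le _ _ _ 8) => n.
have U0 : (0 < U)%N by rewrite muln_gt0.
have adm : admissible_order k (n.+2 * U)%N.
  by rewrite mulnA; apply: ring_admissible.
apply: le_trans (c_ge_density adm); move: {HX adm}(HX n) U0.
move: U (max_induced_path_number _ _) => u M + u_gt0.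
rewrite -(ler_nat R) -!muln2 natrD !natrM => HX.
have n0 : 0 < n.+2%:R :> R by rewrite ltr0n.
have u1 : 1 <= u%:R :> R by rewrite ler1n.
have u0 : 0 < u%:R :> R by rewrite ltr0n.
rewrite ler_pdivlMr ?mulr_gt0 //.
have -> : (1 - X%:R / (u%:R * 2) - 8%:R / n.+2%:R) * (n.+2%:R * u%:R) =
    n.+2%:R * u%:R - n.+2%:R * X%:R / 2 - 8%:R * u%:R :> R.
  by field; rewrite !gt_eqF.
lra.
Qed.

End LowerBound.

(** With [k = 2h + 1], [h (2h + 2) = (k^2 - 1) / 2] and thus [2 U = k^2 (k - 1)^2]. Per hub, the
    dart bound is 4 for the hub itself and [4 + h (2h + 2)] for each of its [k (k - 2)] gadgets; the
    resulting bound equals the stated one. *)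
Lemma c_ge_odd (R : realType) (h : nat) : (0 < h)%N ->
  1 / 2 - (3 * h.*2.+1%:R - 4) / (h.*2.+1%:R ^+ 2 * (h.*2.+1%:R - 1)) <=
    c R h.*2.+1.
Proof.
case: h => // h _.
apply: le_trans (@c_ge_ring R h.+1 isT (4 + h.+1.*2.+1 * (h.+1.*2.+1 - 2) *
  (4 + h.+1 * h.+1.*2.+2))%N _); last first.
  move=> n; have := @ring_max_path_number n h.+1 isT.
  rewrite mulnA; move: (h.+1.*2.+1 - 2)%N (4 + h.+1 * _)%N => d W.
  rewrite (_ : n.+2 * (4 + _) = 4 * n.+2 + n.+2 * h.+1.*2.+1 * d * W)%N //.
  lia.
have -> : (h.+1.*2.+1 - 2 = h.*2.+1)%N by rewrite doubleS !subSS subn0.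
rewrite -!muln2 !(natrM, natrD, mulrS) /=.
have h0 : 0 <= h%:R :> R by [].
rewrite le_eqVlt; apply/predU1P; left; field.
by rewrite !gt_eqF.
Qed.

(** For [h = 1] there are [U = 18] vertices per hub, and [26 = 4 * 2 + 3 * 6] comes from two removed
    neighbours and three gadgets with at most 6 used darts each. The formula for general odd [k]
    would give only [2 / 9] here. *)
Lemma c3_ge (R : realType) : 5 / 18 <= c R 3.
Proof.
apply: le_trans (@c_ge_ring R 1 isT 26 _).
  by change (5 / 18 <= 1 - 26 / 36 :> R); lra.
move=> n; have := @ring_max_path_number_cubic n 1 isT.
rewrite -!(mulnA n.+2); move: (max_induced_path_number _ _) => M; lia.
Qed.

(** The deviation from [1 / 2] is [k^-2] times [(3k - 4) / (k - 1)], which is at most 3 for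
    [k >= 2]. *)
Lemma lower_bound_bigO (R : realType) :
  (fun k : nat =>
     1 / 2 - (3 * k%:R - 4) / (k%:R ^+ 2 * (k%:R - 1)) : R^o)
  = cst (1 / 2) +O_\oo (fun k : nat => k%:R ^- 2 : R^o).
Proof.
apply/eqaddOP; near=> K; near=> n.
have x2 : 2 <= n%:R :> R by rewrite ler_nat; near: n; exists 2%N.
have K3 : 3 <= K by near: K; apply: nbhs_pinfty_ge.
rewrite /= /cst fctE addrAC subrr add0r normrN invfM mulrCA normrM.
rewrite [leRHS]mulrC ler_wpM2l // (le_trans _ K3) // ger0_norm.
  by rewrite ler_pdivrMr; lra.
by rewrite divr_ge0; lra.
Unshelve. all: by end_near. Qed.

Theorem theorem24 (R : realType) :
  [/\ 5 / 18 <= c R 3,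
      (forall k : nat, odd k -> (3 < k)%N ->
        1 / 2 - (3 * k%:R - 4) / (k%:R ^+ 2 * (k%:R - 1)) <= c R k)
    & (fun k : nat =>
         1 / 2 - (3 * k%:R - 4) / (k%:R ^+ 2 * (k%:R - 1)) : R^o)
      = cst (1 / 2) +O_\oo (fun k : nat => k%:R ^- 2 : R^o)].
Proof.
split; [exact: c3_ge | move=> k odd_k k3 | exact: lower_bound_bigO].
have kE : k = k./2.*2.+1 by rewrite -[LHS]odd_double_half odd_k.
by rewrite kE; apply: c_ge_odd; lia.
Qed.
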